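(* Let $\pi: H\to G$ be a cover of groups. Then the following are equivalent: (a) $\mathrm{coGal}(\pi)=\{\mathrm{Id}_H\}$. (b) $\pi: H\to G$ is a cellular cover.
   Context: Classes of groups are assumed closed under isomorphisms. Let $\mathcal{F}$ be a class of groups. A group homomorphism $\pi:H\to G$ is an $\mathcal{F}$-precover of $G$ if $H\in\mathcal{F}$ and for all $F\in\mathcal{F}$ the map $\pi_*:\mathrm{Hom}(F,H)\to\mathrm{Hom}(F,G)$, $\pi_*(f)=\pi f$, is surjective. It is an $\mathcal{F}$-cover if, in addition, every endomorphism $f:H\to H$ such that $\pi f=\pi$ is an automorphism. A homomorphism $\pi:H\to G$ is a cover (of $G$) if there exists a class of groups $\mathcal{F}$ such that $\pi$ is an $\mathcal{F}$-cover. The co-Galois group $\mathrm{coGal}(\pi)$ of a cover $\pi:H\to G$ is the subgroup of $\mathrm{Aut}(H)$ consisting of the automorphisms $f$ of $H$ such that $\pi f=\pi$. A group homomorphism $\pi:H\to G$ is a cellular cover (or co-localization) if the map $\pi_*:\mathrm{End}(H)\to\mathrm{Hom}(H,G)$, $\pi_*(f)=\pi f$, is a bijection. *)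

(* Defs.v *)
From HB Require Import structures.
From mathcomp Require Import all_boot.
From mathcomp Require Import boolp classical_sets.

Set Implicit Arguments.
Unset Strict Implicit.
Unset Printing Implicit Defensive.

Local Open Scope group_scope.
Local Open Scope classical_set_scope.

(* [groupType] (arbitrary, possibly infinite groups) carries a [choiceType]
   structure. This is no restriction classically: with the axioms of [boolp],
   every type has one. *)
Notation Hom := UMagmaMorphism.type (only parsing).

Lemma hom_ext (G H : groupType) (f g : Hom G H) : f =1 g -> f = g.
Proof.
case: f g => [f [[f1] [fM]]] [g [[g1] [gM]]] /= /funext fg.
case: _ / fg in g1 gM *.
by rewrite (Prop_irrelevance f1 g1) (Prop_irrelevance fM gM).
Qed.

Definition id_hom (H : groupType) : Hom H H := idfun.

Definition comp_hom (K H G : groupType) (p : Hom H G) (f : Hom K H) : Hom K G :=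
  p \o f.

(* [bijective] asks for a two-sided inverse function, which is then
   automatically a homomorphism. *)
Definition isomorphic (G H : groupType) : Prop :=
  exists f : Hom G H, bijective f.

Definition group_class (F : groupType -> Prop) : Prop :=
  forall G H : groupType, isomorphic G H -> F G -> F H.

Definition is_precover_for (F : groupType -> Prop) (H G : groupType)
    (p : Hom H G) : Prop :=
  F H /\
  forall K : groupType, F K ->
    forall g : Hom K G, exists f : Hom K H, comp_hom p f = g.

Definition is_cover_for (F : groupType -> Prop) (H G : groupType)
    (p : Hom H G) : Prop :=
  is_precover_for F p /\
  forall f : Hom H H, comp_hom p f = p -> bijective f.

Definition is_cover (H G : groupType) (p : Hom H G) : Prop :=
  exists F : groupType -> Prop, group_class F /\ is_cover_for F p.

Definition is_cellular_cover (H G : groupType) (p : Hom H G) : Prop :=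
  bijective (comp_hom p : Hom H H -> Hom H G).

Record Aut (H : groupType) : Type := MkAut {
  aut_hom :> Hom H H;
  aut_bij : bijective aut_hom
}.

HB.instance Definition _ (H : groupType) := gen_eqMixin (Aut H).
HB.instance Definition _ (H : groupType) := gen_choiceMixin (Aut H).

Section AutGroup.
Variable H : groupType.
Implicit Types f g h : Aut H.

Lemma aut_ext f g : f =1 g -> f = g.
Proof.
case: f g => [f f_bij] [g g_bij] /= /hom_ext fg.
case: _ / fg in g_bij *.
by rewrite (Prop_irrelevance f_bij g_bij).
Qed.

Definition id_aut : Aut H := @MkAut H (id_hom H) (Bijective (fun=> erefl) (fun=> erefl)).

Definition aut_mul f g : Aut H :=
  @MkAut H (comp_hom f g) (bij_comp (aut_bij f) (aut_bij g)).

Lemma aut_inv_exists f : exists g : Aut H, cancel f g /\ cancel g f.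
Proof.
have [g fK gK] := aut_bij f.
have gM : {morph g : x y / x * y} := can2_gmulfM fK gK.
have g1 : g 1 = 1 := can2_gmulf1 fK gK.
pose gm := isMultiplicative.Build H H g gM.
pose gu := Multiplicative_isUMagmaMorphism.Build H H g g1.
pose gh : Hom H H := HB.pack g gm gu.
by exists (@MkAut H gh (Bijective gK fK)).
Qed.

Definition aut_inv f : Aut H := sval (cid (aut_inv_exists f)).

Lemma aut_mulA : associative aut_mul.
Proof. by move=> f g h; apply: aut_ext. Qed.

Lemma aut_mul1 : left_id id_aut aut_mul.
Proof. by move=> f; apply: aut_ext. Qed.

Lemma aut_mulr1 : right_id id_aut aut_mul.
Proof. by move=> f; apply: aut_ext. Qed.

Lemma aut_mulV : left_inverse id_aut aut_inv aut_mul.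
Proof.
move=> f; apply: aut_ext => x /=.
by rewrite /aut_inv; case: cid => g [fK gK] /=; rewrite fK.
Qed.

Lemma aut_mulrV : right_inverse id_aut aut_inv aut_mul.
Proof.
move=> f; apply: aut_ext => x /=.
by rewrite /aut_inv; case: cid => g [fK gK] /=; rewrite gK.
Qed.

HB.instance Definition _ := isGroup.Build (Aut H)
  aut_mulA aut_mul1 aut_mulr1 aut_mulV aut_mulrV.

End AutGroup.

Definition coGal (H G : groupType) (p : Hom H G) : set (Aut H) :=
  [set f | comp_hom p f = p].

Lemma coGal_subgroup (H G : groupType) (p : Hom H G) :
  [/\ coGal p 1,
      forall f g, coGal p f -> coGal p g -> coGal p (f * g) &
      forall f, coGal p f -> coGal p f^-1].
Proof.
split=> [|f g pf pg|f pf]; apply: hom_ext => x //=.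
- by rewrite -[in RHS]pg -[in RHS]pf.
- rewrite -[in LHS]pf /=; congr (p _).
  exact: (congr1 (fun h : Aut H => h x) (mulgV f)).
Qed.

(* Main.v *)
Require Import Defs.
From HB Require Import structures.
From mathcomp Require Import all_boot.
From mathcomp Require Import boolp classical_sets.

(** Only injectivity of composition with [p] on endomorphisms is at stake:
    surjectivity is the precover property tested on [H] itself, and conversely
    an injective composition forces every [f] with [p f = p = p id] to be the
    identity.

    Suppose that the co-Galois group is trivial.  Conjugation by an element of
    [ker p] is an automorphism over [G], hence the identity, so [ker p] is
    central ([coGal1_ker_central]).  If [p f = p g], the pointwise quotient
    [x |-> f x / g x] takes values in [ker p], and centrality makes it a
    homomorphism; for the same reason [x |-> x * (f x / g x)] is an
    endomorphism of [H] ([central_twist_hom]).  It lies over [G], so it is an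
    automorphism because [p] is a cover, so it is in the co-Galois group and is
    the identity.  Therefore [f = g]. *)

Local Open Scope group_scope.
Local Open Scope classical_set_scope.

Lemma hom_of_morph (G H : groupType) (f : G -> H) :
  {morph f : x y / x * y} -> exists h : Hom G H, h =1 f.
Proof.
move=> fM; have f1 : f 1 = 1 by apply: (mulgI (f 1)); rewrite -fM !mulg1.
pose fm := isMultiplicative.Build G H f fM.
pose fu := Multiplicative_isUMagmaMorphism.Build G H f f1.
by exists (HB.pack f fm fu : Hom G H).
Qed.

Lemma coGal1_end_id {H G : groupType} {p : Hom H G} {h : Hom H H} :
  coGal p = [set id_aut H] -> bijective h -> (forall x, p (h x) = p x) ->
  h =1 id.
Proof.
move=> p1 h_bij ph x.
have : coGal p (MkAut h_bij) by apply: hom_ext.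
by rewrite p1 => /(congr1 (fun a : Aut H => a x)).
Qed.

Lemma coGal1_ker_central {H G : groupType} {p : Hom H G} :
  coGal p = [set id_aut H] -> forall k, p k = 1 -> forall x, commute x k.
Proof.
move=> p1 k pk x; have [c cE] := hom_of_morph _ _ _ (fun y z => conjMg y z k).
have c_bij : bijective c.
  by exists (fun y => y ^ k^-1) => y; rewrite cE ?conjgK ?conjgKV.
have pc y : p (c y) = p y.
  by rewrite cE /conjg !gmulfM gmulfV !pk invg1 mul1g mulg1.
by apply/commgP/conjg_fixP; rewrite -cE; apply: coGal1_end_id p1 c_bij pc x.
Qed.

(** Centrality is used twice: to reorder [f x * (f y / g y) / g x], which makes
    the quotient multiplicative, and then to move its value at [x] past [y]. *)
Lemma central_twist_hom (H : groupType) (f g : Hom H H) :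
  (forall x y, commute y (f x / g x)) ->
  exists h : Hom H H, forall x, h x = x * (f x / g x).
Proof.
move=> fgC; apply: hom_of_morph => x y.
have -> : f (x * y) / g (x * y) = f x / g x * (f y / g y).
  by rewrite !gmulfM invgM -mulgA (mulgA (f y)) -(fgC y) mulgA.
move: (f x / g x) (fgC x y) => u uC.
by rewrite -!mulgA (mulgA y u) uC !mulgA.
Qed.

Theorem theorem3p1 (H G : groupType) (p : Hom H G) (hp : is_cover p) :
  coGal p = [set id_aut H] <-> is_cellular_cover p.
Proof.
have [F [_ [[FH p_lift] p_bij]]] := hp; split=> [p1|[q pK _]]; last first.
  apply/seteqP; split=> [f pf|_ ->]; last exact: hom_ext.
  apply: aut_ext => x.
  have fE : aut_hom f = id_hom H.
    by apply: (can_inj pK); rewrite [LHS]pf; apply: hom_ext.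
  by rewrite fE.
have p_inj : injective (comp_hom p : Hom H H -> Hom H G).
  move=> f g pfg; apply: hom_ext => x.
  have pfg1 y : p (f y / g y) = 1.
    have /= e := congr1 (fun a : Hom H G => a y) pfg.
    by rewrite gmulfM gmulfV e mulgV.
  have [h hE] := central_twist_hom _ f g
    (fun y => coGal1_ker_central p1 _ (pfg1 y)).
  have ph y : p (h y) = p y by rewrite hE gmulfM pfg1 mulg1.
  have h_bij : bijective h by apply: p_bij; apply: hom_ext.
  have := coGal1_end_id p1 h_bij ph x.
  by rewrite hE -[RHS]mulg1 => /mulgI/divg1_eq.
pose s g := sval (cid (p_lift H FH g)).
have sK g : comp_hom p (s g) = g by rewrite /s; case: cid.
by exists s => // f; apply: p_inj.
Qed.
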